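(* Suppose that $(x_n)_{n\in\mathbb{N}}$ is a stationary and ergodic sequence of random variables, that $P(x_1\in(-1,1))=1$, and that $E(\gamma_1)$ is well defined, possibly infinite. Let $\varepsilon_x=\operatorname{sign}(E(\gamma_1))$. If $\varepsilon_x\neq0$, then for any $\delta>0$ (such that $\overline{\mathcal{D}}_\delta\neq\emptyset$), the following holds with probability one: $$\lim_{n\to\infty}\frac1n\log\Bigl(\sup_{z\in\overline{\mathcal{D}}_\delta}\bigl|U_n(z)-\varepsilon_x\alpha\bigr|\Bigr)=-\bigl|E(\gamma_1)\bigr|.$$
   Context: $\mathcal{D}$ is the open unit disk in $\mathbb{C}$ centered at $0$, $\overline{\mathcal{D}}$ its closure, $\partial\mathcal{D}$ the unit circle. Fix $\alpha\in\partial\mathcal{D}$. For $x\in(-1,1)$ let $q_{x,\alpha}(z)=\frac{z+x\alpha}{1+x\bar\alpha z}$ for $z\in\overline{\mathcal{D}}$. For $\gamma\in\mathbb{R}$ let $g_\gamma:=q_{x,\alpha}$ where $x\in(-1,1)$ is determined by $\gamma=\log\frac{1+x}{1-x}$. Given the sequence $(x_n)$, put $\gamma_n=\log\frac{1+x_n}{1-x_n}$, $\omega_0=0$, $\omega_n=\sum_{i=1}^n\gamma_i$, and $U_n:=g_{\omega_n}$ for $n\in\mathbb{Z}_+=\mathbb{N}\cup\{0\}$. For $\delta>0$ and $z\in\mathbb{C}$ let $N_\delta(z)=\{w\in\mathbb{C}:|z-w|<\delta\}$, and $\overline{\mathcal{D}}_\delta:=\overline{\mathcal{D}}\setminus\bigl(N_\delta(\alpha)\cup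 N_\delta(-\alpha)\bigr)$. *)

(* Defs.v *)
From mathcomp Require Import all_boot all_order all_algebra.
From mathcomp Require Import all_classical all_reals all_analysis.
From mathcomp Require Import ring lra.
From mathcomp Require Export complex.
Export numFieldNormedType.Exports.
Export ComplexField.Normc.

Set Implicit Arguments.
Unset Strict Implicit.
Unset Printing Implicit Defensive.

Import Order.TTheory GRing.Theory Num.Theory.

Local Open Scope classical_set_scope.
Local Open Scope ring_scope.
Local Open Scope complex_scope.

Section sequence_space.
Context {R : realType}.

Definition cylinders : set (set (nat -> R)) :=
  [set (fun u => u n) @^-1` A | n in [set: nat] & A in measurable].

(* The product (Kolmogorov) sigma-algebra on R^nat. *)
Definition seq_measurable : set (set (nat -> R)) := <<s cylinders >>.

Definition seq_shift (u : nat -> R) : nat -> R := fun n => u n.+1.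

Context {d : measure_display} {T : measurableType d} (P : probability T R).

Definition sample_path (X : nat -> T -> R) (w : T) : nat -> R :=
  fun n => X n w.

Definition stationary (X : nat -> T -> R) : Prop :=
  forall B, seq_measurable B ->
    P (sample_path X @^-1` (seq_shift @^-1` B)) = P (sample_path X @^-1` B).

Definition ergodic (X : nat -> T -> R) : Prop :=
  forall B, seq_measurable B -> seq_shift @^-1` B = B ->
    P (sample_path X @^-1` B) = 0%E \/ P (sample_path X @^-1` B) = 1%E.

Definition expectation_well_defined (Y : T -> R) : Prop :=
  ('E_P[Y^\+] < +oo)%E \/ ('E_P[Y^\-] < +oo)%E.

End sequence_space.

Definition esign {R : realType} (y : \bar R) : R :=
  if (0 < y)%E then 1 else if (y < 0)%E then -1 else 0.

Section disk_automorphisms.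
Context {R : realType}.
Implicit Types (alpha z : R[i]) (x y gamma delta : R).

Definition unit_disk : set R[i] := [set z | normc z < 1].

(* [R[i]^o] is [R[i]] equipped with the topology of its norm. *)
Definition closed_unit_disk : set R[i] := closure (unit_disk : set R[i]^o).

Definition disk_nbhd delta z : set R[i] := [set w | normc (z - w) < delta].

Definition truncated_disk alpha delta : set R[i] :=
  closed_unit_disk `\` (disk_nbhd delta alpha `|` disk_nbhd delta (- alpha)).

Definition q alpha x z : R[i] :=
  (z + x%:C * alpha) / (1 + x%:C * alpha^* * z).

Definition log_ratio x : R := ln ((1 + x) / (1 - x)).

Definition log_ratio_inv gamma : R :=
  xget 0 [set x | -1 < x < 1 /\ gamma = log_ratio x].

Lemma log_ratio_bij gamma :
  exists! x, -1 < x < 1 /\ gamma = log_ratio x.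
Proof.
have e0 := expR_gt0 gamma.
have e1 : expR gamma + 1 != 0 by rewrite gt_eqF// addr_gt0.
exists ((expR gamma - 1) / (expR gamma + 1)); split.
  split; first by rewrite ltr_pdivlMr ?ltr_pdivrMr ?addr_gt0//; lra.
  rewrite /log_ratio (_ : _ / (1 - _) = expR gamma) ?expRK//.
  by field; rewrite e1 /=; lra.
move=> x [/andP[xl xr] ->]; rewrite /log_ratio lnK; last first.
  by rewrite posrE divr_gt0//; lra.
have x1 : 1 - x != 0 by rewrite gt_eqF// subr_gt0.
by field; rewrite x1 /=; lra.
Qed.

Lemma log_ratio_invP gamma :
  -1 < log_ratio_inv gamma < 1 /\ gamma = log_ratio (log_ratio_inv gamma).
Proof.
apply: (@xgetPex _ 0 [set x | -1 < x < 1 /\ gamma = log_ratio x]).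
by have [x [Hx _]] := log_ratio_bij gamma; exists x.
Qed.

Definition g alpha gamma : R[i] -> R[i] := q alpha (log_ratio_inv gamma).

(* The sequence is indexed from 0: [u i] stands for x_(i+1). *)
Definition omega (u : nat -> R) (n : nat) : R := \sum_(i < n) log_ratio (u i).

Definition U alpha (u : nat -> R) (n : nat) : R[i] -> R[i] :=
  g alpha (omega u n).

End disk_automorphisms.

(* Main.v *)
(**
Write [omega_n] for the sum of the [gamma_i]. When [eps * omega_n >= 0], the
identity
  [g_gamma z - alpha = (1 - x) (z - alpha) / (1 + x conj(alpha) z)]
together with [1 - x = (1 + x) exp (- gamma)] squeezes the supremum between two
constant multiples of [exp (- eps * omega_n)]; the case [eps = -1] reduces to
[eps = 1] through [g_(alpha, gamma) = g_(- alpha, - gamma)]. So the theorem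
amounts to [omega_n / n --> E gamma_1], which is the ergodic theorem for the
shift on the path space, with a possibly infinite mean.

For the ergodic theorem it suffices that [inf_n S_n > -oo] almost surely
whenever [f] is integrable with positive mean (apply this to [f - c] and to
[- f - c], and truncate [f] from above when its mean is infinite). The set where
[inf_n S_n = -oo] is strictly invariant, hence of probability 0 or 1, and
probability 1 is excluded by a maximal inequality.
*)
From HB Require Import structures.
Require Import Defs.
From mathcomp Require Import all_boot all_order all_algebra.
From mathcomp Require Import all_classical all_reals all_analysis.
From mathcomp Require Import measurable_realfun ring lra.
Import Order.TTheory GRing.Theory Num.Theory.

Local Open Scope classical_set_scope.
Local Open Scope ring_scope.
Local Open Scope complex_scope.

(** * Birkhoff sums, their running minima, and the event that they are unbounded below *)

Section birkhoff_sums.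
Context {S : Type} {R : realType}.
Variable theta : S -> S.
Implicit Types f : S -> R.

Definition birkhoff_sum f n u : R := \sum_(i < n) f (iter i theta u).

(** This is the minimum of the Birkhoff sums of orders 0 to [n]. Recursing on the first term of the
    orbit gives [M_(n+1) = min(0, f + M_n \o theta)], the form that the maximal inequality uses. *)
Fixpoint running_min f n u : R :=
  if n is n'.+1 then Num.min 0 (f u + running_min f n' (theta u)) else 0.

Definition unbounded_below f : set S :=
  [set u | forall k : nat, exists n, birkhoff_sum f n u < - k%:R].

Lemma birkhoff_sumS f n u :
  birkhoff_sum f n.+1 u = f u + birkhoff_sum f n (theta u).
Proof.
rewrite /birkhoff_sum big_ord_recl; congr (_ + _).
by apply: eq_bigr => i _; rewrite /bump /= -iterSr -iterS.
Qed.

Lemma running_min_le f n k u : (k <= n)%N ->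
  running_min f n u <= birkhoff_sum f k u.
Proof.
elim: n k u => [|n IH] [|k] u //= kn; rewrite ?/birkhoff_sum ?big_ord0//.
  by rewrite ge_min lexx.
rewrite -/(birkhoff_sum f k.+1 u) birkhoff_sumS.
by rewrite ge_min lerD2l IH// orbT.
Qed.

Lemma running_min_noninc f n u : running_min f n.+1 u <= running_min f n u.
Proof.
elim: n u => [|n IH] u; first by rewrite /= ge_min lexx.
by rewrite [leRHS]/= le_min ge_min lexx /= ge_min lerD2l IH orbT.
Qed.

(** The sums started at [u] and at [theta u] differ by the single term [f u] and a shift of the
    index. The equality of sets is strict, as ergodicity is stated for strictly invariant sets. *)
Lemma unbounded_below_invariant f :
  theta @^-1` unbounded_below f = unbounded_below f.
Proof.
apply/seteqP; split => u /= h k.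
  (* The extra term in the threshold exceeds [|f u|] and absorbs the first summand. *)
  have [n hn] := h (k + Num.truncn `|f u|).+1%N; exists n.+1.
  rewrite birkhoff_sumS.
  have := ltW (truncnS_gt `|f u|); have := ler_norm (f u).
  move: hn; rewrite -addnS natrD; lra.
(* Order 0 is impossible: the empty sum is not below a negative number. *)
have [[|n] hn] := h (k + Num.truncn `|f u|).+1%N.
  move: hn; rewrite /birkhoff_sum big_ord0 oppr_gt0.
  by rewrite ltNge ler0n.
exists n; move: hn; rewrite birkhoff_sumS.
have := ltW (truncnS_gt `|f u|); have := ler_norm (- f u); rewrite normrN.
rewrite -addnS natrD; lra.
Qed.

End birkhoff_sums.

(** * Measure-preserving ergodic maps and the maximal inequality *)

Section birkhoff.
Context {d : measure_display} {S : measurableType d} {R : realType}.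
Variables (Q : probability S R) (theta : S -> S).
Hypothesis mtheta : measurable_fun setT theta.
Hypothesis theta_preserving :
  forall B, measurable B -> Q (theta @^-1` B) = Q B.
Hypothesis theta_ergodic :
  forall B, measurable B -> theta @^-1` B = B -> Q B = 0%E \/ Q B = 1%E.
Implicit Types f : S -> R.

Local Notation birkhoff_sum := (birkhoff_sum theta).
Local Notation running_min := (running_min theta).
Local Notation unbounded_below := (unbounded_below theta).

Lemma measurable_iter n : measurable_fun setT (iter n theta).
Proof.
elim: n => [|n IH]; first exact: measurable_id.
exact: measurableT_comp.
Qed.

Lemma measurable_birkhoff_sum f n : measurable_fun setT f ->
  measurable_fun setT (birkhoff_sum f n).
Proof.
move=> mf; apply: measurable_sum => i.
exact: measurableT_comp (measurable_iter i).
Qed.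

Lemma measurable_running_min f n : measurable_fun setT f ->
  measurable_fun setT (running_min f n).
Proof.
move=> mf; elim: n => [|n IH] /=; first exact: measurable_cst.
apply: measurable_minr; first exact: measurable_cst.
by apply: measurable_funD => //; exact: measurableT_comp.
Qed.

Lemma measurable_unbounded_below f : measurable_fun setT f ->
  measurable (unbounded_below f).
Proof.
move=> mf.
have -> : unbounded_below f =
    \bigcap_k \bigcup_n (birkhoff_sum f n @^-1` `]-oo, - k%:R[).
  apply/seteqP; split => u /=.
    by move=> h k _; have [n ?] := h k; exists n; rewrite //= in_itv.
  by move=> h k; have [n _] := h k I; rewrite /= in_itv/=; exists n.
apply: bigcapT_measurable => k; apply: bigcupT_measurable => n.
by rewrite -[X in measurable X]setTI; exact: measurable_birkhoff_sum.
Qed.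

Lemma ge0_integral_comp_preserving (h : S -> \bar R) :
  measurable_fun setT h -> (forall u, 0 <= h u)%E ->
  (\int[Q]_u h (theta u) = \int[Q]_u h u)%E.
Proof.
move=> mh h0.
rewrite -[LHS](@ge0_integral_pushforward _ _ _ _ _ theta mtheta Q setT)//.
by apply: eq_measure_integral => B mB _; exact: theta_preserving.
Qed.

Lemma integrable_comp_preserving (h : S -> R) :
  Q.-integrable setT (EFin \o h) -> Q.-integrable setT (EFin \o (h \o theta)).
Proof.
move=> /integrableP[mh ih]; apply/integrableP; split.
  exact: (measurableT_comp mh).
rewrite (ge0_integral_comp_preserving (fun u => `|(h u)%:E|)%E) //.
by apply: measurableT_comp mh.
Qed.

Lemma Rintegral_comp_preserving (h : S -> R) :
  Q.-integrable setT (EFin \o h) ->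
  \int[Q]_u h (theta u) = \int[Q]_u h u.
Proof.
move=> ih; rewrite /Rintegral; congr fine.
have /= <- := @integral_pushforward _ _ _ _ _ theta mtheta Q setT (EFin \o h)
  (measurable_int _ ih) (integrable_comp_preserving _ ih) measurableT.
by apply: eq_measure_integral => B mB _; exact: theta_preserving.
Qed.

(** By induction on [n], since [|min(0, s)| <= |s|] with [s = f + M_n \o theta]. *)
Lemma integrable_running_min f n : Q.-integrable setT (EFin \o f) ->
  Q.-integrable setT (EFin \o running_min f n).
Proof.
move=> fi; have /measurable_EFinP mf := measurable_int _ fi.
elim: n => [|n IH]; first exact: (finite_measure_integrable_cst Q 0).
have sumi : Q.-integrable setT (EFin \o (f \+ (running_min f n \o theta))).
  exact: (integrableD _ fi (integrable_comp_preserving _ IH)).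
apply: le_integrable sumi => //.
  by apply/measurable_EFinP; exact: measurable_running_min.
move=> u _ /=; rewrite lee_fin.
by rewrite minElt; case: ifP => _; rewrite ?normr0 ?normr_ge0.
Qed.

(* If [inf_n S_n = -oo] almost surely, the running minimum [M_n] of
   [0, S_1, ..., S_n] tends to [-oo], while
   [max(0, f + M_n \o theta) = f + M_n \o theta - M_(n+1)] has integral at least
   that of [f]; by domination by [|f|] the former integral tends to 0. *)
Lemma unbounded_below_null f : Q.-integrable setT (EFin \o f) ->
  0 < \int[Q]_u f u -> Q (unbounded_below f) = 0%E.
Proof.
move=> fi f0; have /measurable_EFinP mf := measurable_int _ fi.
have mA := measurable_unbounded_below _ mf.
have [//|QA1] := theta_ergodic _ mA (unbounded_below_invariant theta f).
have aeA : {ae Q, forall u, unbounded_below f u}.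
  exists (~` unbounded_below f); split; first exact: measurableC.
    by rewrite probability_setC// QA1 subee.
  by [].
pose h n u := Num.max 0 (f u + running_min f n (theta u)).
have hE n u : h n u = f u + running_min f n (theta u) - running_min f n.+1 u.
  by rewrite /h /=; case: leP; rewrite ?subr0 ?subrr.
have mi n := integrable_running_min f n fi.
have mci n := integrable_comp_preserving _ (mi n).
have sumi n : Q.-integrable setT (EFin \o (f \+ (running_min f n \o theta))).
  exact: (integrableD _ fi (mci n)).
have hi n : Q.-integrable setT (EFin \o h n).
  have := integrableB measurableT (sumi n) (mi n.+1).
  by apply: eq_integrable => // u _; rewrite /= hE.
(* Invariance of [Q] replaces [M_n \o theta] by [M_n] under the integral, and
   [M_n - M_(n+1) >= 0]. *)
have h_ge n : \int[Q]_u f u <= \int[Q]_u h n u.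
  under [leRHS]eq_Rintegral do rewrite hE.
  rewrite RintegralB//; last exact: sumi.
  rewrite RintegralD//; last exact: mci.
  rewrite Rintegral_comp_preserving// -addrA lerDl subr_ge0.
  by apply: le_Rintegral => // u _; exact: running_min_noninc.
(* Since [M_n <= S_0 = 0], the maximum is at most the positive part of [f]. *)
have h_le n u : (`|(h n u)%:E| <= `|(f u)%:E|)%E.
  rewrite lee_fin /h ger0_norm ?le_max ?lexx// ge_max normr_ge0 /=.
  rewrite (le_trans _ (ler_norm _))// gerDl.
  have := running_min_le theta f _ _ (theta u) (leq0n n).
  by rewrite /birkhoff_sum big_ord0.
have h_cvg : {ae Q, forall u, setT u -> (h n u)%:E @[n --> \oo] --> 0%E}.
  apply: filterS aeA => u Au _.
  (* By invariance [theta u] also has unbounded sums, so eventually [M_n (theta u) < - |f u|] and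
     [h n u] is exactly 0. *)
  have /(_ (Num.truncn `|f u|).+1) [k hk] : unbounded_below f (theta u).
    by rewrite -[unbounded_below f]unbounded_below_invariant in Au.
  apply: cvg_near_cst; exists k => // n /= kn.
  rewrite /h; congr EFin; apply/max_idPl.
  have := running_min_le theta f _ _ (theta u) kn.
  have := ltW (truncnS_gt `|f u|); have := ler_norm (f u); lra.
have [_ _ cvgh] := @dominated_convergence _ _ _ Q setT measurableT
  (fun n => EFin \o h n) (cst 0%E) (fun u => `|(f u)%:E|%E)
  (fun n => measurable_int _ (hi n)) (measurable_cst _) h_cvg
  (integrable_abse fi) (aeW _ (fun u n _ => h_le n u)).
move: cvgh; rewrite integral0 => cvgh.
suff : (\int[Q]_u (f u)%:E <= 0)%E.
  rewrite -[X in (X <= _)%E]fineK; last exact: integrable_fin_num fi.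
  by rewrite lee_fin leNgt f0.
rewrite -(cvg_lim _ cvgh)//; apply: lime_ge; first by apply: cvgP cvgh.
apply: nearW => n /=.
have := h_ge n; rewrite -lee_fin /Rintegral !fineK//.
  exact: integrable_fin_num (hi n).
exact: integrable_fin_num fi.
Qed.

End birkhoff.

(** * From linear lower bounds to limits of averages in the extended reals *)

Section averages.
Context {R : realType}.
Implicit Types (a : nat -> R) (m : \bar R).

(** A bound for all [n] with one constant [K]: exactly what a finite infimum of the sums of [f - c]
    provides. *)
Definition asymptotic_slope_ge a (c : R) : Prop :=
  exists K, forall n, n%:R * c - K <= a n.

Lemma asymptotic_slope_ge_near a (c c' : R) : asymptotic_slope_ge a c ->
  c' < c -> \forall n \near \oo, c' <= n%:R^-1 * a n.
Proof.
move=> [K aK] cc'; near=> n.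
have n0 : 0 < n%:R :> R by rewrite ltr0n; near: n; exact: nbhs_infty_gt.
rewrite ler_pdivlMl// (le_trans _ (aK n))// lerBrDl -lerBrDr -mulrBr.
rewrite -ler_pdivrMr ?subr_gt0//.
by near: n; exact: nbhs_infty_ger.
Unshelve. all: by end_near. Qed.

(** Only rational slopes are required, so that countably many almost sure statements will suffice.
    Bounds on [a] and on [- a] give the lower and the upper half of the limit. *)
Lemma cvge_average a m :
  (forall q : rat, ((ratr q)%:E < m)%E -> asymptotic_slope_ge a (ratr q)) ->
  (forall q : rat, ((ratr q)%:E < - m)%E ->
    asymptotic_slope_ge (fun n => - a n) (ratr q)) ->
  (n%:R^-1 * a n)%:E @[n --> \oo] --> m.
Proof.
have key (b : nat -> R) (l : \bar R) :
    (forall q : rat, ((ratr q)%:E < l)%E -> asymptotic_slope_ge b (ratr q)) ->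
    forall c : R, (c%:E < l)%E -> \forall n \near \oo, c <= n%:R^-1 * b n.
  move=> h c cl.
  (* The slack between [c] and [q] absorbs [K / n]. The endpoint [c + 1] serves for [l = +oo];
     [l = -oo] is excluded by [c < l]. *)
  have [q /[!in_itv]/= /andP[cq ql]] :
      exists q : rat, ratr q \in `]c, if l is r%:E then r else c + 1[.
    by apply: rat_in_itvoo; case: l cl {h} => [r|_|//]; rewrite ?lte_fin ?ltrDl.
  apply: asymptotic_slope_ge_near cq; apply: h.
  by case: l ql cl => [r|_|//]; rewrite ?lte_fin ?ltry.
move=> /key lo /key hi.
case: m lo hi => [r| |] lo hi.
- apply: cvg_EFin; first exact: nearW.
  apply/cvgrPdist_le => e e0 /=.
  have lor : \forall n \near \oo, r - e <= n%:R^-1 * a n.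
    by apply: lo; rewrite lte_fin gtrDl oppr_lt0.
  have hir : \forall n \near \oo, - r - e <= n%:R^-1 * - a n.
    by apply: hi; rewrite -EFinN lte_fin gtrDl oppr_lt0.
  near=> n; rewrite ler_distlC; apply/andP; split; first by near: n.
  rewrite -lerN2 -mulrN opprD; near: n; exact: hir.
- by apply/cvgeyPge => A; apply: filterS (lo A (ltry _)) => n; rewrite lee_fin.
- apply/cvgeNyPle => A; apply: filterS (hi (- A) (ltry _)) => n.
  by rewrite mulrN lerN2 lee_fin.
Unshelve. all: by end_near. Qed.

End averages.

(** * The ergodic theorem, with a possibly infinite mean *)

Section birkhoff_theorem.
Context {d : measure_display} {S : measurableType d} {R : realType}.
Variables (Q : probability S R) (theta : S -> S).
Hypothesis mtheta : measurable_fun setT theta.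
Hypothesis theta_preserving :
  forall B, measurable B -> Q (theta @^-1` B) = Q B.
Hypothesis theta_ergodic :
  forall B, measurable B -> theta @^-1` B = B -> Q B = 0%E \/ Q B = 1%E.
Implicit Types f : S -> R.
Local Notation birkhoff_sum := (birkhoff_sum theta).

(** The function [f - c] has positive mean, so almost surely its sums stay above some [- k], and [k]
    is the constant [K] for [f]. *)
Lemma birkhoff_sum_lower_integrable f (c : R) :
  Q.-integrable setT (EFin \o f) -> c < \int[Q]_u f u ->
  {ae Q, forall u, asymptotic_slope_ge (fun n => birkhoff_sum f n u) c}.
Proof.
move=> fi cf; have /measurable_EFinP mf := measurable_int _ fi.
have ci := finite_measure_integrable_cst Q c measurableT.
pose h u := f u - c.
have hi : Q.-integrable setT (EFin \o h).
  by have := integrableB measurableT fi ci; apply: eq_integrable.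
have h0 : 0 < \int[Q]_u h u.
  rewrite RintegralB//.
  by rewrite Rintegral_cst// [X in fine X](probability_setT Q) mulr1 subr_gt0.
have mh : measurable_fun setT h.
  by apply/measurable_EFinP; exact: measurable_int hi.
exists (unbounded_below theta h); split.
- exact: (measurable_unbounded_below theta mtheta).
- exact: unbounded_below_null.
move=> u /=; apply: contra_notP => /existsNP[k /forallNP hk].
exists k%:R => n.
have := hk n; move/negP.
rewrite -leNgt /birkhoff_sum /h sumrB sumr_const card_ord.
by rewrite -[c *+ n]mulr_natl; lra.
Qed.

Lemma birkhoff_sum_le f h n u : (forall u, f u <= h u) ->
  birkhoff_sum f n u <= birkhoff_sum h n u.
Proof. by move=> fh; apply: ler_sum. Qed.

(* Since [+oo - +oo = -oo] in [\bar R], the hypothesis on the integral forces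
   the negative part of [f] to be integrable. *)
Lemma truncation_integral_gt f (c : R) : measurable_fun setT f ->
  (c%:E < \int[Q]_u (f u)%:E)%E ->
  exists k : nat, Q.-integrable setT (EFin \o (fun u => Num.min (f u) k%:R)) /\
    c < \int[Q]_u (Num.min (f u) k%:R).
Proof.
move=> mf; pose p u := Num.max (f u) 0; pose q u := Num.max (- f u) 0.
pose t (k : nat) u := Num.min (f u) k%:R.
pose tp (k : nat) u := Num.min (p u) k%:R.
have p0 u : 0 <= p u by rewrite /p le_max lexx orbT.
have q0 u : 0 <= q u by rewrite /q le_max lexx orbT.
(* Truncating from above leaves the negative part untouched, so monotone convergence is needed for
   the positive part only. *)
have tE k u : t k u = tp k u - q u.
  have := ler0n R k; rewrite /t /tp /p /q.
  by do !case: leP => ?; lra.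
have tp0 k u : 0 <= tp k u by rewrite /tp le_min p0 ler0n.
have mp : measurable_fun setT p by apply: measurable_maxr.
have mq : measurable_fun setT q.
  by apply: measurable_maxr => //; exact: measurable_funN.
have mtp k : measurable_fun setT (tp k) by apply: measurable_minr.
have fE : (\int[Q]_u (f u)%:E = \int[Q]_u (p u)%:E - \int[Q]_u (q u)%:E)%E.
  rewrite integralE; congr (_ - _)%E; apply: eq_integral => u _.
    by rewrite funeposE /p EFin_max.
  by rewrite funenegE /q EFin_max.
rewrite fE => cpq.
have Iq0 : (0 <= \int[Q]_u (q u)%:E)%E.
  by apply: integral_ge0 => u _; rewrite lee_fin.
have Iqy : (\int[Q]_u (q u)%:E < +oo)%E.
  rewrite ltey; apply/eqP => qoo; move: cpq; rewrite qoo.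
  by rewrite addeNy.
have qi : Q.-integrable setT (EFin \o q).
  apply/integrableP; split; first exact/measurable_EFinP.
  by under eq_integral => u _ do rewrite /= ger0_norm//.
have tpi k : Q.-integrable setT (EFin \o tp k).
  apply: (le_integrable measurableT _ _
    (finite_measure_integrable_cst Q k%:R measurableT)).
    exact/measurable_EFinP.
  move=> u _ /=; rewrite lee_fin !ger0_norm//.
  by rewrite /tp ge_min lexx orbT.
have ti k : Q.-integrable setT (EFin \o t k).
  have := integrableB measurableT (tpi k) qi.
  by apply: eq_integrable => // u _; rewrite /= tE.
have cvgtp :
    (\int[Q]_u (tp k u)%:E @[k --> \oo] --> \int[Q]_u (p u)%:E)%E.
  have -> : (\int[Q]_u (p u)%:E = \int[Q]_u limn (fun k => (tp k u)%:E))%E.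
    apply: eq_integral => u _; apply/esym/cvg_lim => //; apply: cvg_near_cst.
    exists (Num.truncn (p u)).+1 => // k /= pk; rewrite /tp; congr EFin.
    apply/min_idPl; rewrite (le_trans (ltW (truncnS_gt _)))//.
    by rewrite ler_nat.
  apply: (@cvg_monotone_convergence _ _ _ Q setT measurableT
    (fun k => EFin \o tp k)).
  - by move=> k; exact/measurable_EFinP.
  - by move=> k u _; rewrite lee_fin.
  - move=> u _ k l kl; rewrite lee_fin /tp le_min ge_min lexx/= ge_min.
    by rewrite ler_nat kl orbT.
have qfin : (\int[Q]_u (q u)%:E)%E \is a fin_num by rewrite ge0_fin_numE.
(* If every truncated mean were at most [c], the limit would give that the integral of [p] is at
   most [c] plus that of [q]. *)
apply: contrapT => /forallNP hk.
move: cpq; rewrite lteBrDr// ltNge => /negP; apply.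
rewrite -(cvg_lim _ cvgtp)//; apply: lime_le; first exact: cvgP cvgtp.
apply: nearW => k; rewrite leNgt; apply/negP => ck.
apply: (hk k); split; first exact: ti.
rewrite (eq_Rintegral _ (g := fun u => tp k u - q u)); last first.
  by move=> u _; exact: tE.
rewrite RintegralB// -lte_fin EFinB /Rintegral !fineK//; last first.
  exact: integrable_fin_num (tpi k).
by rewrite lteBrDr.
Qed.

Lemma birkhoff_sum_lower f (c : R) : measurable_fun setT f ->
  (c%:E < \int[Q]_u (f u)%:E)%E ->
  {ae Q, forall u, asymptotic_slope_ge (fun n => birkhoff_sum f n u) c}.
Proof.
move=> mf /(truncation_integral_gt _ _ mf)[k [ti ct]].
apply: filterS (birkhoff_sum_lower_integrable _ _ ti ct) => u [K hK].
exists K => n; apply: le_trans (hK n) _; apply: birkhoff_sum_le => v.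
by rewrite ge_min lexx.
Qed.

Theorem birkhoff f : measurable_fun setT f ->
  (\int[Q]_u (f^\+ u)%:E < +oo)%E \/ (\int[Q]_u (f^\- u)%:E < +oo)%E ->
  {ae Q, forall u,
    (n%:R^-1 * birkhoff_sum f n u)%:E @[n --> \oo] --> (\int[Q]_u (f u)%:E)%E}.
Proof.
move=> mf fwd.
(* One finite part ensures that the difference of the two parts is never [+oo - +oo], so the sign
   can be moved out. *)
have fN : (\int[Q]_u ((- f u)%:E) = - \int[Q]_u (f u)%:E)%E.
  under eq_integral do rewrite EFinN.
  apply: integralN; rewrite -/(EFin \o f) funerpos funerneg.
  case: fwd => [p_fin|n_fin].
    apply: fin_num_adde_defr; rewrite ge0_fin_numE//.
    by apply: integral_ge0 => u _; rewrite lee_fin.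
  apply: fin_num_adde_defl; rewrite fin_numN ge0_fin_numE//.
  by apply: integral_ge0 => u _; rewrite lee_fin.
(* Enumerating the rationals by [unpickle] merges the null sets, one for each slope, into one. *)
have lo : {ae Q, forall u, forall n : nat, forall q, unpickle n = Some q ->
    ((ratr q)%:E < \int[Q]_u (f u)%:E)%E ->
    asymptotic_slope_ge (fun n => birkhoff_sum f n u) (ratr q)}.
  apply: ae_foralln => n; case: (unpickle n) => [q|]; last exact: aeW.
  have [qf|qf] := boolP ((ratr q)%:E < \int[Q]_u (f u)%:E)%E; last first.
    by apply: aeW => u _ [<-]; rewrite (negPf qf).
  by apply: filterS (birkhoff_sum_lower _ _ mf qf) => u h _ [<-].
have hi : {ae Q, forall u, forall n : nat, forall q, unpickle n = Some q ->
    ((ratr q)%:E < - \int[Q]_u (f u)%:E)%E ->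
    asymptotic_slope_ge (fun n => - birkhoff_sum f n u) (ratr q)}.
  apply: ae_foralln => n; case: (unpickle n) => [q|]; last exact: aeW.
  rewrite -fN.
  have [qf|qf] := boolP ((ratr q)%:E < \int[Q]_u (- f u)%:E)%E; last first.
    by apply: aeW => u _ [<-]; rewrite (negPf qf).
  apply: filterS (birkhoff_sum_lower _ _ (measurable_funN mf) qf).
  move=> u [K hK] _ [<-] _; exists K => k; apply: le_trans (hK k) _.
  by rewrite /birkhoff_sum -sumrN.
apply: filterS2 lo hi => u lo hi.
apply: cvge_average => q; [apply: lo | apply: hi]; exact: pickleK.
Qed.

End birkhoff_theorem.

(** * Uniform estimates for the disk automorphisms *)

Section disk.
Context {R : realType}.
Implicit Types (alpha beta z w : R[i]) (gamma delta x : R).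

Lemma normc_conj z : normc z^* = normc z.
Proof. by case: z => a b; rewrite /normc/= sqrrN. Qed.

Lemma normc_real x : normc x%:C = `|x|.
Proof. by rewrite /normc/= expr0n /= addr0 sqrtr_sqr. Qed.

Lemma normr_normc z : `|z| = (normc z)%:C.
Proof. by case: z. Qed.

Lemma mul_conj_normc1 beta : normc beta = 1 -> beta * beta^* = 1.
Proof.
by move=> b1; rewrite -sqr_normc normr_normc b1 expr1n.
Qed.

Lemma closed_unit_disk_le1 z : closed_unit_disk z -> normc z <= 1.
Proof.
move=> /= zD; apply/ler_addgt0Pr => e e0.
have e0C : 0 < e%:C :> R[i] by rewrite ltcR.
have [w [/= w1 zw]] :=
  zD _ (nbhsx_ballx (z : R[i]^o) (PosNum e0C)%:num (gt0 _)).
have : `|z - w| < e%:C by [].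
rewrite normr_normc ltcR => zwe.
rewrite -[z](subrK w) (le_trans (le_normcD _ _))// addrC lerD//; exact: ltW.
Qed.

Lemma log_ratioN x : -1 < x < 1 -> log_ratio (- x) = - log_ratio x.
Proof.
move=> /andP[x0 x1]; rewrite /log_ratio opprK -lnV ?invf_div//.
by rewrite posrE divr_gt0//; lra.
Qed.

Lemma log_ratio_invN gamma : log_ratio_inv (- gamma) = - log_ratio_inv gamma.
Proof.
have [xb xE] := log_ratio_invP gamma.
have [y [_ yuniq]] := log_ratio_bij (- gamma).
rewrite -(yuniq _ (log_ratio_invP _)) -(yuniq (- log_ratio_inv gamma))//.
split; first by lra.
by rewrite log_ratioN// -xE.
Qed.

Lemma gNN alpha gamma z : g (- alpha) (- gamma) z = g alpha gamma z.
Proof.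
by rewrite /g /q log_ratio_invN !rmorphN /= mulrNN mulrNN.
Qed.

Lemma truncated_diskN alpha delta :
  truncated_disk (- alpha) delta = truncated_disk alpha delta.
Proof. by rewrite /truncated_disk opprK setUC. Qed.

Lemma expR_log_ratio_inv gamma :
  (1 - log_ratio_inv gamma) * expR gamma = 1 + log_ratio_inv gamma.
Proof.
have [/andP[x0 x1] {2}->] := log_ratio_invP gamma.
rewrite /log_ratio lnK ?posrE ?divr_gt0//; try lra.
by rewrite mulrC divfK//; lra.
Qed.

Lemma normc_g_sub beta gamma z : normc beta = 1 ->
  let x := log_ratio_inv gamma in
  1 + x%:C * beta^* * z != 0 ->
  normc (g beta gamma z - beta) =
    (1 - x) * normc (beta - z) / normc (1 + x%:C * beta^* * z).
Proof.
move=> b1 x D0.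
have -> : g beta gamma z - beta =
    (1 - x)%:C * (z - beta) / (1 + x%:C * beta^* * z).
  rewrite /g /q -/x -[X in _ - X](mulfK D0) -mulrBl; congr (_ / _).
  have := mul_conj_normc1 _ b1; rewrite rmorphB /= => bb.
  rewrite mulrDr mulr1 mulrA mulrCA bb; ring.
rewrite normcM normcV normcM normc_real ger0_norm; last first.
  by have [/andP[]] := log_ratio_invP gamma; rewrite -/x; lra.
by rewrite -[z - beta]opprB normcN.
Qed.

(** Two lower bounds compete: [1 - x], good for small [x], and [delta - (1 - x)], good for [x] near
    1 because [z] stays away from [- beta]. They add up to [delta], so one of them is at least
    [delta / 2]. *)
Lemma denominator_bounds beta delta x z : normc beta = 1 -> 0 <= x < 1 ->
  truncated_disk beta delta z ->
  delta / 2 <= normc (1 + x%:C * beta^* * z) <= 2.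
Proof.
move=> b1 /andP[x0 x1] [/closed_unit_disk_le1 z1 /not_orP[_ /negP]].
rewrite /disk_nbhd /= -leNgt -opprD normcN => dz.
set w := beta^* * z; rewrite -mulrA -/w.
have w1 : normc w <= 1 by rewrite normcM normc_conj b1 mul1r.
have dw : delta <= normc (1 + w).
  have -> : 1 + w = beta^* * (beta + z).
    by rewrite mulrDr mulrC mul_conj_normc1.
  by rewrite normcM normc_conj b1 mul1r.
have xw : normc (x%:C * w) <= x.
  by rewrite normcM normc_real ger0_norm// ler_piMr.
have up : normc (1 + x%:C * w) <= 1 + x.
  by rewrite (le_trans (le_normcD _ _))// normc1 lerD2l.
have lo1 : 1 - x <= normc (1 + x%:C * w).
  rewrite lerBlDr -[leLHS](@normc1 R) -{1}[1](addrK (x%:C * w)).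
  by rewrite (le_trans (le_normcD _ _))// lerD2l normcN.
have lo2 : delta <= normc (1 + x%:C * w) + (1 - x).
  have e : 1 + w = (1 + x%:C * w) + (1 - x)%:C * w by rewrite rmorphB /=; ring.
  rewrite (le_trans dw)// e (le_trans (le_normcD _ _))// lerD2l.
  have y0 : 0 <= 1 - x by rewrite subr_ge0 ltW.
  by rewrite normcM normc_real ger0_norm// ler_piMr.
by apply/andP; split; lra.
Qed.

Lemma sup_g_bounds beta delta gamma : normc beta = 1 -> 0 < delta ->
  truncated_disk beta delta !=set0 -> 0 <= gamma ->
  let s := sup [set normc (g beta gamma z - beta)
                | z in truncated_disk beta delta] in
  delta / 2 * expR (- gamma) <= s /\ s <= 8 / delta * expR (- gamma).
Proof.
move=> b1 d0 [z0 z0D] g0 s.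
have [/andP[xN1 x1] _] := log_ratio_invP gamma.
have xE := expR_log_ratio_inv gamma.
set x := log_ratio_inv gamma in xN1 x1 xE.
have e1 : 1 <= expR gamma by rewrite -expR0 ler_expR.
(* This follows from [(1 - x) * expR gamma = 1 + x] with [expR gamma >= 1]. *)
have x0 : 0 <= x by nra.
have x01 : 0 <= x < 1 by rewrite x0.
have eN : expR (- gamma) * expR gamma = 1 by rewrite -expRD addNr expR0.
have eN0 : 0 < expR (- gamma) := expR_gt0 _.
have yE : 1 - x = (1 + x) * expR (- gamma).
  by rewrite -xE -mulrA (mulrC (expR gamma)) eN mulr1.
(* Apart from [expR (- gamma)], the numerator [(1 + x) * |beta - z|] lies between [delta] and 4, the
   denominator between [delta / 2] and 2. *)
have bound z : truncated_disk beta delta z ->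
    delta / 2 * expR (- gamma) <= normc (g beta gamma z - beta)
      <= 8 / delta * expR (- gamma).
  move=> zD; have /andP[D1 D2] := denominator_bounds _ _ _ _ b1 x01 zD.
  have D0 : 0 < normc (1 + x%:C * beta^* * z) by apply: lt_le_trans D1; lra.
  rewrite normc_g_sub //; last first.
    by apply: contraTneq D0 => ->; rewrite normc0 ltxx.
  rewrite -/x.
  have [/closed_unit_disk_le1 z1 /not_orP[/negP]] := zD.
  rewrite /disk_nbhd /= -leNgt => dz _.
  have bz : normc (beta - z) <= 2.
    by rewrite (le_trans (le_normcD _ _))// normcN b1; lra.
  move: (normc _) (normc _) D0 D1 D2 dz bz => a D D0 D1 D2 da a2.
  rewrite yE; set t := expR _ in eN0 *.
  rewrite ler_pdivlMr// ler_pdivrMr//; apply/andP; split.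
    have -> : delta / 2 * t * D = t * (delta * (D / 2)) by field.
    have -> : (1 + x) * t * a = t * ((1 + x) * a) by ring.
    have a_le : a <= (1 + x) * a by rewrite ler_peMl//; lra.
    rewrite ler_pM2l// (le_trans _ a_le)// (le_trans _ da)//.
    by rewrite ler_piMr ?(ltW d0)//; lra.
  have -> : 8 / delta * t * D = t * (8 * (D / delta)) by ring.
  have -> : (1 + x) * t * a = t * ((1 + x) * a) by ring.
  rewrite ler_pM2l//.
  have : 2^-1 <= D / delta by rewrite ler_pdivlMr//; lra.
  have : (1 + x) * a <= 4 by nra.
  lra.
have nonempty : [set normc (g beta gamma z - beta)
                | z in truncated_disk beta delta] !=set0.
  by exists (normc (g beta gamma z0 - beta)), z0.
have ub : ubound [set normc (g beta gamma z - beta)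
                | z in truncated_disk beta delta] (8 / delta * expR (- gamma)).
  by move=> _ [z zD <-]; have /andP[] := bound z zD.
split; last exact: ge_sup.
have /andP[h _] := bound z0 z0D; apply: le_trans h _.
by apply: ub_le_sup; [exists (8 / delta * expR (- gamma)) | exists z0].
Qed.

(** The point is that [K] does not depend on [gamma]: after division by [n] the error vanishes. Both
    signs reduce to the attracting point [beta = eps * alpha]. *)
Lemma ln_sup_g_bound alpha delta (eps : R) : normc alpha = 1 -> 0 < delta ->
  truncated_disk alpha delta !=set0 -> (eps = 1 \/ eps = -1) ->
  exists K, forall gamma, 0 <= eps * gamma ->
    `|ln (sup [set normc (g alpha gamma z - eps%:C * alpha)
               | z in truncated_disk alpha delta]) + eps * gamma| <= K.
Proof.
move=> a1 d0 D0 eps1.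
exists (`|ln (delta / 2)| + `|ln (8 / delta)|) => gamma g0.
have [beta [b1 bD bE]] : exists beta, [/\ normc beta = 1,
    truncated_disk beta delta = truncated_disk alpha delta &
    forall z, g alpha gamma z - eps%:C * alpha = g beta (eps * gamma) z - beta].
  case: eps1 {g0} => ->; [exists alpha|exists (- alpha)]; split=> //.
  - by move=> z; rewrite !mul1r.
  - by rewrite normcN.
  - by rewrite truncated_diskN.
  - by move=> z; rewrite mulN1r gNN rmorphN1 mulN1r.
rewrite -bD in D0 *.
under eq_imagel => z _ do rewrite bE.
have := sup_g_bounds _ _ _ b1 d0 D0 g0.
set s := sup _; set t := expR _ => -[lo hi].
have t0 : 0 < t := expR_gt0 _.
have d20 : 0 < delta / 2 by rewrite divr_gt0.
have d80 : 0 < 8 / delta by rewrite divr_gt0.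
have s0 : 0 < s by apply: lt_le_trans lo; rewrite mulr_gt0.
move: lo hi; rewrite -ler_ln ?posrE ?(mulr_gt0 d20)//.
rewrite -[s <= _]ler_ln ?posrE ?(mulr_gt0 d80)//.
rewrite (lnM d20 t0) (lnM d80 t0) /t expRK => lo hi.
rewrite ler_norml; have := ler_norm (ln (8 / delta)).
have := ler_norm (- ln (delta / 2)).
have := normr_ge0 (ln (8 / delta)); have := normr_ge0 (ln (delta / 2)).
by rewrite normrN => *; apply/andP; split; lra.
Qed.

End disk.

(** * Transfer of the ergodic theorem from path space to the random sequence *)

Section stationary_sequences.
Context {R : realType} {d : measure_display} {T : measurableType d}.
Variables (P : probability T R) (x : nat -> {RV P >-> R}).
Local Notation seqT := (g_sigma_algebraType (@cylinders R)).

Lemma measurable_log_ratio : measurable_fun setT (@log_ratio R).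
Proof.
(* Outside []-1, 1[] the quotient is at most 0, also at [y = 1] where division by zero gives 0, and
   [ln] is 0 there by convention. *)
have -> : @log_ratio R =
    fun y => if (- 1 < y) && (y < 1) then ln (1 + y) - ln (1 - y) else 0.
  apply/funext => y; rewrite /log_ratio; case: ifPn => [/andP[y0 y1]|y01].
    by rewrite ln_div ?posrE//; lra.
  apply: ln0; rewrite negb_and -!leNgt in y01; case/orP: y01 => [y0|y1].
    by rewrite mulr_le0_ge0 ?invr_ge0//; lra.
  by rewrite mulr_ge0_le0 ?invr_le0//; lra.
apply: measurable_fun_ifT; last exact: measurable_cst.
- by apply: measurable_and; apply: measurable_fun_ltr.
- have mD : measurable_fun setT (fun y : R => 1 + y) by apply: measurable_funD.
  have mB : measurable_fun setT (fun y : R => 1 - y) by apply: measurable_funB.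
  apply: measurable_funB; first exact: measurableT_comp mD.
  exact: measurableT_comp mB.
Qed.

Lemma measurable_sample_path :
  measurable_fun setT (sample_path (fun n => x n) : T -> seqT).
Proof.
apply: (@measurability _ _ _ seqT _ _ (@cylinders R)) => //.
move=> _ [_ [n _ [A mA <-]] <-].
exact: (measurable_funP (x n)).
Qed.

Lemma measurable_seq_shift :
  measurable_fun setT (seq_shift : seqT -> seqT).
Proof.
apply: (@measurability _ _ _ seqT _ _ (@cylinders R)) => //.
move=> _ [_ [n _ [A mA <-]] <-].
by rewrite setTI; apply: sub_sigma_algebra; exists n.+1 => //; exists A.
Qed.

Lemma measurable_coord n : measurable_fun setT (fun u : seqT => u n).
Proof.
move=> _ A mA; rewrite setTI; apply: sub_sigma_algebra.
by exists n => //; exists A.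
Qed.

Lemma birkhoff_sum_omega (u : nat -> R) n :
  birkhoff_sum seq_shift (fun u => log_ratio (u 0%N)) n u = omega u n.
Proof.
apply: eq_bigr => i _; congr log_ratio.
suff h k : iter i seq_shift u k = u (i + k)%N by rewrite h addn0.
by elim: (i : nat) k => //= j IH k; rewrite /seq_shift IH addnS.
Qed.

Lemma cvg_omega_average : stationary P (fun n w => x n w) ->
  ergodic P (fun n w => x n w) ->
  expectation_well_defined P (fun w => log_ratio (x 0%N w)) ->
  {ae P, forall w, (n%:R^-1 * omega (x ^~ w) n)%:E @[n --> \oo]
    --> 'E_P[fun w => log_ratio (x 0%N w)]%E}.
Proof.
move=> stat erg wd.
pose path : {mfun T >-> seqT} :=
  HB.pack (sample_path (fun n => x n) : T -> seqT)
    (isMeasurableFun.Build _ _ _ _ _ measurable_sample_path).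
(* Under the law of the path, stationarity and ergodicity of the sequence are literally the two
   hypotheses on the shift. *)
pose Q := distribution P path.
pose f (u : seqT) := log_ratio (u 0%N).
have mf : measurable_fun setT f.
  by apply: (measurableT_comp measurable_log_ratio); exact: measurable_coord.
have ge0E (h : seqT -> R) : measurable_fun setT h -> (forall u, 0 <= h u) ->
    (\int[Q]_u (h u)%:E = \int[P]_w (h (path w))%:E)%E.
  move=> mh h0; rewrite ge0_integral_distribution//.
  exact/measurable_EFinP.
have pE := ge0E _ (measurable_funrpos mf) (funrpos_ge0 f).
have nE := ge0E _ (measurable_funrneg mf) (funrneg_ge0 f).
(* The parts are compared separately, since change of variables for nonnegative functions needs no
   integrability. *)
have fE : (\int[Q]_u (f u)%:E = 'E_P[fun w => log_ratio (x 0%N w)])%E.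
  rewrite unlock integralE [RHS]integralE -!/(EFin \o _) !funerpos !funerneg.
  by rewrite pE nE.
have wdQ : (\int[Q]_u (f^\+ u)%:E < +oo)%E \/ (\int[Q]_u (f^\- u)%:E < +oo)%E.
  by move: wd; rewrite /expectation_well_defined unlock pE nE.
have [N [mN QN0 NP]] :=
  birkhoff Q seq_shift measurable_seq_shift stat erg f mf wdQ.
exists (path @^-1` N); split.
- by rewrite -[X in measurable X]setTI; exact: measurable_sample_path.
- exact: QN0.
- move=> w /= hw; apply: NP => /= h; apply: hw.
  by rewrite fE in h; under eq_fun do rewrite -birkhoff_sum_omega.
Qed.

End stationary_sequences.

(** * Passage from the drift of [omega] to the decay rate of the supremum *)

Lemma cvg_average_add_bounded {R : realType} (a b : nat -> R) (m : \bar R)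
    (K : R) :
  (\forall n \near \oo, `|a n + b n| <= K) ->
  (n%:R^-1 * b n)%:E @[n --> \oo] --> m ->
  (n%:R^-1 * a n)%:E @[n --> \oo] --> (- m)%E.
Proof.
move=> abK bm.
have r0 : n%:R^-1 * (a n + b n) @[n --> \oo] --> (0 : R).
  have K0 : n%:R^-1 * K @[n --> \oo] --> (0 : R).
    rewrite -(mul0r K); apply: cvgMl.
    (* The library's harmonic sequence is [1 / (n + 1)], hence the shift. *)
    by rewrite -cvg_shiftS; exact: cvg_harmonic.
  apply/norm_cvg0P.
  apply: (squeeze_cvgr _ (cvg_cst 0) K0).
  apply: filterS abK => n abn.
  by rewrite normr_ge0 /= normrM ger0_norm// ler_wpM2l.
have e n : ((n%:R^-1 * a n)%:E =
    - (n%:R^-1 * b n)%:E + (n%:R^-1 * (a n + b n))%:E)%E.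
  by rewrite -EFinN -EFinD; congr EFin; ring.
under eq_fun do rewrite e.
(* The error has the finite limit 0, so the sum of limits is defined even for infinite [m]. *)
rewrite -[(- m)%E]adde0; apply: cvgeD.
- by rewrite fin_num_adde_defl.
- exact: cvgeN.
- by apply: cvg_EFin => //; exact: nearW.
Qed.

Theorem theorem3 (R : realType) (alpha : R[i]) (d : measure_display)
    (T : measurableType d) (P : probability T R) (x : nat -> {RV P >-> R}) :
  normc alpha = 1 ->
  stationary P (fun n w => x n w) ->
  ergodic P (fun n w => x n w) ->
  P [set w | -1 < x 0%N w < 1] = 1%E ->
  expectation_well_defined P (fun w => log_ratio (x 0%N w)) ->
  let m : \bar R := 'E_P[fun w => log_ratio (x 0%N w)]%E in
  let eps : R := esign m in
  eps != 0 ->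
  forall delta : R, 0 < delta -> truncated_disk alpha delta !=set0 ->
  {ae P, forall w,
    (n%:R^-1 * ln (sup [set normc (U alpha (fun i => x i w) n z
                                    - eps%:C * alpha)
                       | z in truncated_disk alpha delta]))%:E
      @[n --> \oo] --> (- `|m|)%E}.
Proof.
move=> a1 stat erg _ wd m eps eps0 delta d0 D0.
have eps1 : eps = 1 \/ eps = - 1.
  move: eps0; rewrite /eps /esign; case: ifP => _; first by left.
  by case: ifP => _; [right | rewrite eqxx].
have [K hK] := ln_sup_g_bound alpha delta eps a1 d0 D0 eps1.
apply: filterS (cvg_omega_average P x stat erg wd) => w cw.
(* Multiplying by [eps] turns the limit [m] into [|m|], which handles both signs at once. *)
have cew : (n%:R^-1 * (eps * omega (x ^~ w) n))%:E @[n --> \oo] --> (`|m|)%E.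
  rewrite /eps /esign; move: eps0; rewrite /eps /esign.
  case: ifPn => [m0 _|_]; last case: ifPn => [m0 _|_]; last by rewrite eqxx.
    rewrite gee0_abs ?ltW//.
    by under eq_fun do rewrite mul1r.
  rewrite lte0_abs//.
  under eq_fun do rewrite mulN1r mulrN EFinN.
  exact: cvgeN.
apply: (cvg_average_add_bounded _ _ _ K _ cew).
have m0 : (0 < `|m|)%E.
  rewrite lt_def abse_ge0 andbT abse_eq0.
  by apply: contra_neq eps0 => m0; rewrite /eps /esign m0 ltxx.
(* A positive limit makes [eps * omega] nonnegative from some index on, the range where the disk
   estimate holds. *)
have : \forall n \near \oo, (0 < (n%:R^-1 * (eps * omega (x ^~ w) n))%:E)%E.
  exact: (cew _ (open_ereal_gt_ereal m0)).
apply: filterS => n; rewrite lte_fin => n0.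
apply: hK; rewrite leNgt; apply/negP => neg.
by move: n0; rewrite ltNge mulr_ge0_le0 ?invr_ge0// ltW.
Qed.
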